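(* Every (possibly randomized, possibly adaptive) query algorithm for Graph Reconstruction using a Maximal Independent Set oracle that succeeds with probability strictly greater than $1/2$ when the input graph is an $n$-vertex cycle requires $\Omega(\log n)$ queries.
   Context: Graph Reconstruction problem: an algorithm initially knows only the vertex set $V$ ($|V|=n$) of an unknown simple undirected input graph $G=(V,E)$ and must determine $E$. Access to $G$ is only via a Maximal Independent Set oracle: in each query the algorithm submits a subset $U\subseteq V$, and the oracle returns an arbitrary (possibly adversarially chosen) maximal independent set of the induced subgraph $G[U]$. The query complexity is the number of oracle calls. *)

(* Defs.v *)
From mathcomp Require Import all_boot all_order all_algebra.
From mathcomp Require Import all_classical all_reals all_analysis.

Set Implicit Arguments.
Unset Strict Implicit.
Unset Printing Implicit Defensive.

Import Order.TTheory GRing.Theory Num.Theory.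

Local Open Scope classical_set_scope.

(* A graph on the known vertex set V is identified with its edge set, a set of
   two-element subsets of V. *)
Definition simple_graph (V : finType) (E : {set {set V}}) : bool :=
  [forall e in E, #|e| == 2].

Definition induced_edges (V : finType) (E : {set {set V}}) (U : {set V}) :
  {set {set V}} := [set e in E | e \subset U]%SET.

Definition independent (V : finType) (E : {set {set V}}) (S : {set V}) : bool :=
  [forall e in E, ~~ (e \subset S)].

Definition maximal_independent (V : finType) (E : {set {set V}})
    (U I : {set V}) : bool :=
  maxset [pred S : {set V} | (S \subset U) && independent (induced_edges E U) S] I.

(* ordS is the cyclic successor i |-> i + 1 mod #|V| on 'I_#|V|, so E is the
   edge set of a cycle through all the vertices of V. *)
Definition is_cycle (V : finType) (E : {set {set V}}) : Prop :=
  2 < #|V| /\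
  exists s : 'I_#|V| -> V,
    bijective s /\ E = [set [set s i; s (ordS i)]%SET | i : 'I_#|V|]%SET.

Lemma cycle_simple (V : finType) (E : {set {set V}}) :
  is_cycle E -> simple_graph E.
Proof.
case=> V2 [s [bs ->]]; apply/forall_inP => _ /imsetP[i _ ->].
rewrite cards2 (inj_eq (bij_inj bs)).
suff -> : i != ordS i by [].
apply/eqP => /(congr1 val) /= /esym ei.
have := ltn_ord i; rewrite leq_eqVlt => /orP[/eqP Ei|lti].
  by move: ei; rewrite Ei modnn => i0; rewrite -Ei -i0 in V2.
by move: ei; rewrite modn_small // => /eqP; rewrite gtn_eqF.
Qed.

(* A deterministic adaptive algorithm: a decision tree that either outputs an
   edge set, or queries U and continues according to the answer.  Branching is
   over the finite type {set V}, so every tree has finite depth. *)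
Inductive det_alg (V : finType) : Type :=
| Output of {set {set V}}
| Query of {set V} & ({set V} -> det_alg V).

(* The pairs (query, answer) so far, oldest first. *)
Definition transcript (V : finType) := seq ({set V} * {set V}).

(* The answer may depend on the whole interaction so far, so that an adversary
   may choose it adaptively, and need not repeat itself on repeated queries. *)
Definition oracle (V : finType) := transcript V -> {set V} -> {set V}.

Definition mis_oracle (V : finType) (E : {set {set V}}) (O : oracle V) : Prop :=
  forall (h : transcript V) (U : {set V}), maximal_independent E U (O h U).

Fixpoint run_from (V : finType) (O : oracle V) (h : transcript V)
    (a : det_alg V) : transcript V * {set {set V}} :=
  match a with
  | Output E => (h, E)
  | Query U k => run_from O (rcons h (U, O h U)) (k (O h U))
  end.

Definition output (V : finType) (O : oracle V) (a : det_alg V) :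
  {set {set V}} := (run_from O [::] a).2.

Definition queries (V : finType) (O : oracle V) (a : det_alg V) : nat :=
  size (run_from O [::] a).1.

(* A randomized algorithm draws all its coins in advance from an arbitrary
   probability space.  For a fixed V there are only countably many decision
   trees, and they carry the discrete sigma-algebra. *)
Record rand_alg (R : realType) (V : finType) := RandAlg {
  coin_display : measure_display ;
  coins : measurableType coin_display ;
  coin_law : probability coins R ;
  alg_of_coins : coins -> det_alg V ;
  measurable_alg_of_coins :
    forall S : set (det_alg V), measurable (alg_of_coins @^-1` S)
}.

Definition success_probability (R : realType) (V : finType)
    (A : rand_alg R V) (E : {set {set V}}) (O : oracle V) : \bar R :=
  coin_law A [set w : coins A | output O (alg_of_coins w) = E].

Definition reconstructs_cycles (R : realType) (V : finType)
    (A : rand_alg R V) : Prop :=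
  forall (E : {set {set V}}) (O : oracle V), is_cycle E -> mis_oracle E O ->
    ((2^-1 : R)%:E < success_probability A E O)%E.

(* Worst case over the cycle, the oracle's answers and the coins. *)
Definition queries_on_cycles_le (R : realType) (V : finType)
    (A : rand_alg R V) (q : nat) : Prop :=
  forall (E : {set {set V}}) (O : oracle V), is_cycle E -> mis_oracle E O ->
    forall w : coins A, queries O (alg_of_coins w) <= q.

(* Main.v *)
(** Fix for every cycle one oracle consistent with it.  For each outcome of the
    coins the output is determined by the answers, at most q subsets of V, so it
    is correct for at most 2^(nq) cycles.  Averaging over the coins, the success
    probabilities of all the cycles add up to at most 2^(nq); each exceeds 1/2,
    so there are at most 2 * 2^(nq) cycles.  There are at least n!/n^2 of them,
    and n^n <= n!^2, which forces q to be of order log n. *)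

Require Import Defs.
From mathcomp Require Import all_boot all_order all_algebra.
From mathcomp Require Import all_classical all_reals all_analysis.
From mathcomp Require Import measurable_realfun zify.
Import Order.TTheory GRing.Theory Num.Theory.
Local Open Scope ring_scope.

(** Two copies of the factorial, one reversed, pair the factors [i.+1] and [n - i], whose product
    exceeds [n] by [i] times [n - i - 1]. *)
Lemma expnn_leq_sqr_fact (n : nat) : (n ^ n <= n`! ^ 2)%N.
Proof.
have factE : n`! = (\prod_(i < n) i.+1)%N by rewrite fact_prod big_add1 big_mkord.
have factE_rev : n`! = (\prod_(i < n) (n - i))%N.
  rewrite factE (reindex_inj rev_ord_inj) /=.
  by apply: eq_bigr => i _; rewrite subnSK.
rewrite -mulnn {1}factE factE_rev -big_split /=.
rewrite -[X in (n ^ X)%N](card_ord n) -prod_nat_const.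
by apply: leq_prod => i _; have := ltn_ord i; nia.
Qed.

Section Cycles.
Variable V : finType.

Definition cycle_edges (s : 'I_#|V| -> V) : {set {set V}} :=
  [set [set s i; s (ordS i)]%SET | i : 'I_#|V|]%SET.

Definition cycles : {set {set {set V}}} := [set E | `[< is_cycle E >]]%SET.

(* A parametrised cycle is recovered from two consecutive vertices: each next
   vertex is the neighbour of the current one that is not the previous one. *)
Lemma cycle_edges_inj (s t : 'I_#|V| -> V) (i0 i1 : 'I_#|V|) :
  (2 < #|V|)%N -> i0 = 0%N :> nat -> i1 = 1%N :> nat -> injective s -> injective t ->
  cycle_edges s = cycle_edges t -> s i0 = t i0 -> s i1 = t i1 -> s =1 t.
Proof.
move=> V2 i0E i1E sI tI st s0 s1.
(* Induct on pairs of consecutive positions; the last position occurs only as [j], so the induction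
   never wraps around. *)
suff H (k : nat) (i j : 'I_#|V|) : i = k :> nat -> j = k.+1 :> nat ->
    s i = t i /\ s j = t j.
  move=> i; have [n1|] := ltnP i.+1 #|V|.
    by have [] := H i i (Ordinal n1) erefl erefl.
  case: i => [[|k] kV] /= n1; first by have := leq_trans V2 n1.
  by have [] := H k (Ordinal (ltnW kV)) (Ordinal kV) erefl erefl.
elim: k i j => [|k IH] i j iE jE.
  by rewrite (val_inj (etrans iE (esym i0E))) (val_inj (etrans jE (esym i1E))).
have kV : (k < #|V|)%N by have := ltn_ord i; rewrite iE; apply: ltnW.
pose h := Ordinal kV.
have [shE siE] := IH h i erefl iE.
split=> //.
have hS : ordS h = i.
  by apply: val_inj; rewrite /= modn_small; [exact/esym | rewrite -iE ltn_ord].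
have iS : ordS i = j.
  by apply: val_inj; rewrite /= iE modn_small; [exact/esym | rewrite -jE ltn_ord].
(* This edge contains [s i], so as an edge of [s] it starts at [i] or at the predecessor [h]; the
   latter would put [t j] in {[t h], [t i]}. *)
have : [set t i; t j]%SET \in cycle_edges s.
  by rewrite st -iS; apply: imset_f.
move=> /imsetP[l _ tE].
have tij : t i != t j.
  by apply/eqP => /tI ij; move: jE; rewrite -ij iE => /eqP; rewrite ltn_eqF.
have thj : t h != t j.
  by apply/eqP => /tI hj; move: jE; rewrite -hj /= => /eqP; rewrite ltn_eqF.
have := set21 (t i) (t j); rewrite tE !inE => /orP[] /eqP til.
  have li : l = i by apply: sI; rewrite siE.
  have := set22 (t i) (t j); rewrite tE li iS !inE siE => /orP[] /eqP // tji.
  by rewrite tji eqxx in tij.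
have lh : l = h.
  by apply: (can_inj (@ordSK _)); rewrite hS; apply: sI; rewrite siE.
have := set22 (t i) (t j); rewrite tE lh hS !inE shE siE => /orP[] /eqP tj.
  by rewrite tj eqxx in thj.
by rewrite tj eqxx in tij.
Qed.

(** A bijective parametrisation is determined by its cycle and its first two vertices. The crude
    factor [#|V| ^ 2] for these vertices suffices. *)
Lemma fact_leq_card_cycles : (2 < #|V|)%N -> ((#|V|)`! <= #|cycles| * #|V| ^ 2)%N.
Proof.
move=> V2.
pose i0 := Ordinal (ltnW (ltnW V2)); pose i1 := Ordinal (ltnW V2).
pose F := [set f : {ffun 'I_#|V| -> V} | injectiveb f]%SET.
pose code (f : {ffun 'I_#|V| -> V}) := (cycle_edges f, (f i0, f i1)).
have -> : (#|V|)`! = #|F|.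
  by rewrite card_inj_ffuns card_ord ffactnn.
have code_inj : {in F &, injective code}.
  move=> f g; rewrite !inE => /injectiveP fI /injectiveP gI [fg f0 f1].
  by apply/ffunP; apply: (@cycle_edges_inj f g i0 i1).
rewrite -(card_in_imset code_inj).
have -> : (#|cycles| * #|V| ^ 2 = #|finset.setX cycles [set: V * V]|)%N.
  by rewrite cardsX cardsT card_prod mulnn.
apply/subset_leq_card/fintype.subsetP => _ /imsetP[f fF ->].
rewrite !inE andbT; apply/asboolP; split=> //; exists f; split=> //.
by apply: inj_card_bij; [move: fF; rewrite inE => /injectiveP | rewrite card_ord].
Qed.

End Cycles.

(** Edges are nonempty, so the empty set is independent and extends to a maximal independent set. *)
Lemma mis_oracle_exists (V : finType) (E : {set {set V}}) :
  simple_graph E -> exists O : oracle V, mis_oracle E O.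
Proof.
move=> /forall_inP sE.
have [|f fP] := @choice _ _ (fun U I : {set V} => maximal_independent E U I).
  move=> U.
  have [|I maxI _] := @maxset_exists _ [pred S : {set V} |
    (S \subset U) && independent (induced_edges E U) S] finset.set0.
    rewrite /= finset.sub0set; apply/forall_inP => e; rewrite inE => /andP[eE _].
    by rewrite finset.subset0 -cards_eq0 (eqP (sE e eE)).
  by exists I.
by exists (fun _ => f) => h U; apply: fP.
Qed.

Section Counting.
Variable V : finType.

(** Runs the tree on a list of answers alone. Surplus answers are ignored, so lists can be
    padded. *)
Fixpoint replay (a : det_alg V) (s : seq {set V}) : {set {set V}} :=
  match a, s with
  | Output E, _ => E
  | Query _ k, [::] => finset.set0
  | Query _ k, x :: s' => replay (k x) s'
  end.

Lemma run_from_replay (O : oracle V) (a : det_alg V) (h : transcript V) :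
  exists r : transcript V, (run_from O h a).1 = h ++ r /\
    forall s, replay a (unzip2 r ++ s) = (run_from O h a).2.
Proof.
elim: a h => [E|U k IH] h /=; first by exists [::]; rewrite cats0.
have [r [rE rP]] := IH (O h U) (rcons h (U, O h U)).
by exists ((U, O h U) :: r); rewrite rE cat_rcons.
Qed.

Lemma output_replay (O : oracle V) (a : det_alg V) (q : nat) :
  (queries O a <= q)%N -> exists t : q.-tuple {set V}, output O a = replay a t.
Proof.
rewrite /queries /output; have [r [-> rP]] := run_from_replay O a [::] => /= rq.
(* Padding to length exactly [q] makes the answer lists a finite type to count. *)
pose u := unzip2 r ++ nseq (q - size r) finset.set0.
have u_size : size u == q by rewrite size_cat size_nseq size_map subnKC.
by exists (Tuple u_size); rewrite /= rP.
Qed.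

(** Each correctly output [E] is the replay of some [q]-tuple of answers, even though the oracle
    varies with [E]. *)
Lemma card_success_leq (C : {set {set {set V}}}) (O : {set {set V}} -> oracle V)
    (a : det_alg V) (q : nat) :
  {in C, forall E, queries (O E) a <= q}%N ->
  (#|[set E in C | output (O E) a == E]%SET| <= 2 ^ (#|V| * q))%N.
Proof.
move=> Cq.
have <- : #|[set: q.-tuple {set V}]| = (2 ^ (#|V| * q))%N.
  by rewrite cardsT card_tuple -[#|{set V}|]cardsT -powersetT card_powerset cardsT expnM.
apply: leq_trans (leq_imset_card (fun t : q.-tuple _ => replay a t) _).
apply/subset_leq_card/fintype.subsetP => E; rewrite inE => /andP[/Cq Eq /eqP <-].
by have [t ->] := output_replay _ _ _ Eq; apply: imset_f; rewrite inE.
Qed.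

End Counting.

(** The sum is the expected number of events that occur, and this number is at most [M]
    pointwise. *)
Lemma sum_probability_le (d : measure_display) (T : measurableType d)
    (R : realType) (P : probability T R) (I : finType) (C : {set I})
    (A : I -> set T) (M : nat) :
  (forall i, measurable (A i)) ->
  (forall x, #|[set i in C | x \in A i]%SET| <= M)%N ->
  (\sum_(i in C) P (A i) <= M%:R%:E)%E.
Proof.
move=> mA AM.
have -> : (\sum_(i in C) P (A i) = \int[P]_x \sum_(i <- enum C) (\1_(A i) x)%:E)%E.
  rewrite ge0_integral_sum //; last first.
  - by move=> i; apply/measurable_EFinP; exact: measurable_indic.
  by rewrite big_enum; apply: eq_bigr => i _; rewrite integral_indic // setIT.
have -> : (M%:R%:E = \int[P]_(x in setT) (cst M%:R%:E x))%E.
  by rewrite integral_cst //= probability_setT mule1.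
apply: ge0_le_integral => //.
- by move=> x _; apply: sume_ge0 => i _; rewrite lee_fin.
- by apply: emeasurable_sum => i; apply/measurable_EFinP; exact: measurable_indic.
- move=> x _; rewrite big_enum sumEFin lee_fin /=.
  rewrite (_ : \sum_(i in C) _ = #|[set i in C | x \in A i]%SET|%:R).
    by rewrite ler_nat.
  rewrite -sum1_card natr_sum big_mkcond [RHS]big_mkcond /=.
  by apply: eq_bigr => i _; rewrite inE indicE; case: (i \in C); case: (x \in A i).
Qed.

Lemma card_cycles_leq (R : realType) (V : finType) (A : rand_alg R V) (q : nat) :
  reconstructs_cycles A -> queries_on_cycles_le A q ->
  (#|cycles V| <= 2 * 2 ^ (#|V| * q))%N.
Proof.
move=> Asucc Aq.
have [|O OP] :=
    @choice _ _ (fun E (O : oracle V) => is_cycle E -> mis_oracle E O).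
  move=> E; have [cE|nE] := pselect (is_cycle E).
    by have [f fP] := mis_oracle_exists _ _ (cycle_simple cE); exists f.
  (* An arbitrary value off the cycles; the sums below range over cycles only. *)
  by exists (fun _ _ => finset.set0).
pose S E := [set w : coins A | output (O E) (alg_of_coins w) = E]%classic.
have S_le : (\sum_(E in cycles V) coin_law A (S E) <=
    (2 ^ (#|V| * q))%:R%:E)%E.
  apply: sum_probability_le => [E|w].
    exact: (@measurable_alg_of_coins _ _ A [set a | output (O E) a = E]%classic).
  rewrite (_ : [set E in cycles V | w \in S E]%SET =
    [set E in cycles V | output (O E) (alg_of_coins w) == E]%SET).
    apply: card_success_leq => E; rewrite inE => /asboolP cE.
    exact: Aq cE (OP E cE) w.
  apply/setP => E; rewrite !inE; congr (_ && _).
  by apply/idP/eqP => [/set_mem|/mem_set].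
have : (\sum_(E in cycles V) (2^-1 : R)%:E <= (2 ^ (#|V| * q))%:R%:E)%E.
  apply: le_trans S_le; apply: lee_sum => E; rewrite inE => /asboolP cE.
  by apply/ltW/Asucc => //; apply: OP.
rewrite sumEFin lee_fin sumr_const -[_ *+ _]mulr_natr mulrC ler_pdivrMr ?ltr0n //.
by rewrite -natrM ler_nat mulnC.
Qed.

Theorem theorem6 (R : realType) :
  exists c : R, 0 < c /\
  exists N : nat,
    forall (V : finType) (A : rand_alg R V) (q : nat),
      (N <= #|V|)%N ->
      reconstructs_cycles A ->
      queries_on_cycles_le A q ->
      c * ln (#|V|%:R : R) <= q%:R.
Proof.
(* The constant comes from [n <= 2 ^ (4 * q)] together with ln 2 <= 1. *)
exists 4^-1; split; first by rewrite invr_gt0 ltr0n.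
exists 10%N => V A q V10 Asucc Aq.
have V0 : (0 < #|V|)%N by apply: leq_trans V10.
have := card_cycles_leq _ _ _ _ Asucc Aq.
have := @fact_leq_card_cycles V (leq_trans (isT : 2 < 10)%N V10).
have := expnn_leq_sqr_fact #|V|.
move: (#|V|) V10 V0 => n n10 n0 nn fact_le cycles_le.
suff n_le : (n <= 2 ^ (4 * q))%N.
  rewrite mulrC ler_pdivrMr ?ltr0n // -natrM mulnC.
  have : ln (n%:R : R) <= ln ((2 ^ (4 * q))%:R : R).
    by rewrite ler_ln ?posrE ?ltr0n ?expn_gt0 // ler_nat.
  move/le_trans; apply; rewrite natrX lnXn ?ltr0n // -[ln _ *+ _]mulr_natr ler_piMl //.
  by have := @le_ln1Dx R 1; rewrite -natr1 addrC; apply; rewrite (lt_trans _ ltr01) ?ltrN10.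
(* Square the bound on the factorial; the resulting constant 4 is absorbed into a fifth factor
   [n]. *)
have sq_le : (n ^ n <= n ^ 5 * 2 ^ (2 * (n * q)))%N.
  apply: leq_trans nn _.
  apply: (@leq_trans ((2 * 2 ^ (n * q) * n ^ 2) ^ 2)%N).
    by rewrite leq_exp2r //; apply: leq_trans fact_le _; rewrite leq_mul2r cycles_le orbT.
  rewrite !expnMn -!expnM (mulnC (n * q)%N) mulnAC leq_mul2r; apply/orP; right.
  by rewrite -expnD (expnS n 4) leq_mul2r (leq_trans _ n10) // orbT.
have root_le : (n ^ (n - 5) <= 2 ^ (2 * (n * q)))%N.
  rewrite -(@leq_pmul2l (n ^ 5)%N) ?expn_gt0 ?n0 // -expnD subnKC //.
  by apply: leq_trans n10.
(* Compare [n]-th powers: [n <= 2 * (n - 5)], which is where 10 comes from, so squaring [root_le]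
   suffices. *)
rewrite -(@leq_exp2r _ _ n) //.
apply: (@leq_trans ((n ^ (n - 5)) ^ 2)%N).
  by rewrite -expnM leq_pexp2l //; lia.
rewrite -[((2 ^ (4 * q)) ^ n)%N]expnM (_ : 4 * q * n = 2 * (n * q) * 2)%N; last by lia.
by rewrite [leqRHS]expnM leq_exp2r.
Qed.
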